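(* Let $\lambda<1$. The sequence $(\mathbf{x}^{(N)}(\infty))_N$ of stationary states of the SA-JSQ system is tight in $S$ under the $\ell_1$-norm.
   Context: Parameters: $M\in\{1,2,\dots\}$; service rates $\mu_1>\dots>\mu_M>0$; proportions $\gamma_j\in(0,1]$ with $\sum_j\gamma_j=1$ and $\sum_j\gamma_j\mu_j=1$; $\lambda>0$; $N$ ranges over positive integers with $N\gamma_j\in\{1,2,\dots\}$ for all $j\in[M]=\{1,\dots,M\}$. System: $N$ servers, $N\gamma_j$ of type $j$ with service rate $\mu_j$, each with its own infinite-buffer FCFS queue; Poisson arrivals of rate $N\lambda$; i.i.d. exponential job sizes of mean $1$. Speed-Aware JSQ (SA-JSQ): each arriving job joins a server with the minimum queue length (number of jobs including the one in service) among all servers; ties between types are broken in favour of the fastest type (smallest $j$), ties within a type uniformly at random. $\mathbf{x}^{(N)}(t)=(x^{(N)}_{i,j}(t),i\ge1,j\in[M])$, where $x^{(N)}_{i,j}(t)$ is the fraction of type $j$ servers with at least $i$ jobs at time $t$ under SA-JSQ. This Markov chain is positive recurrent for $\lambda<1$; $\mathbf{x}^{(N)}(\infty)$ is a random state distributed according to its unique stationary distribution. $S=\{\mathbf{s}=(s_{i,j})_{i\ge1,j\in[M]}:1\ge s_{i,j}\ge s_{i+1,j}\ge0\ \forall i,j,\ \|\mathbf{s}\|_1<\infty\}$ with $\|\mathbf{s}\|_1=\max_{j\in[M]}\sum_{i\ge1}|s_{i,j}|$. *)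

(* Defs.v *)
From HB Require Import structures.
From mathcomp Require Import all_boot all_order all_algebra.
From mathcomp Require Import archimedean.
From mathcomp Require Import all_classical all_reals all_analysis.

Set Implicit Arguments.
Unset Strict Implicit.
Unset Printing Implicit Defensive.
Import Order.TTheory GRing.Theory Num.Theory.
Import numFieldNormedType.Exports.

Local Open Scope classical_set_scope.
Local Open Scope ring_scope.

(* Arrays (s_{i,j}) with i >= 1 are stored shifted: [s i j] is s_{i+1,j}.
   Likewise the type j in [M] is the ordinal j-1 : 'I_M. *)
Definition l1norm (R : realType) (M : nat) (s : nat -> 'I_M -> R) : \bar R :=
  \big[maxe/0%E]_(j < M) (\sum_(0 <= i <oo) `|s i j|%:E)%E.

Definition in_S (R : realType) (M : nat) (s : nat -> 'I_M -> R) : Prop :=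
  (forall i j, 0 <= s i.+1 j /\ s i.+1 j <= s i j /\ s i j <= 1) /\
  (l1norm s < +oo)%E.

Record occ_space (R : realType) (M : nat) : Type :=
  OccSpace { occ_val :> nat -> 'I_M -> R ; occ_valP : `[< in_S occ_val >] }.

HB.instance Definition _ (R : realType) (M : nat) :=
  [isSub for @occ_val R M].
HB.instance Definition _ (R : realType) (M : nat) :=
  [Choice of occ_space R M by <:].

Definition l1dist (R : realType) (M : nat) (x y : occ_space R M) : R :=
  fine (l1norm (fun i j => x i j - y i j)).

Section L1Metric.
Variables (R : realType) (M : nat).
Implicit Types (s u v : nat -> 'I_M -> R) (x y z : occ_space R M).

Lemma l1norm_ge0 s : (0 <= l1norm s)%E.
Proof.
rewrite /l1norm; elim/big_rec: _ => // j a _ a0.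
by rewrite le_max a0 orbT.
Qed.

Lemma le_l1norm s j : (\sum_(0 <= i <oo) `|s i j|%:E <= l1norm s)%E.
Proof. by rewrite /l1norm (bigmax_sup j). Qed.

Lemma l1norm_le s a : (0 <= a)%E ->
  (forall j, \sum_(0 <= i <oo) `|s i j|%:E <= a)%E -> (l1norm s <= a)%E.
Proof. by move=> a0 sa; apply: bigmax_le => // j _; exact: sa. Qed.

Lemma l1norm_triangle s u v : (forall i j, `|s i j| <= `|u i j| + `|v i j|) ->
  (l1norm s <= l1norm u + l1norm v)%E.
Proof.
move=> suv; apply: l1norm_le => [|j]; first by rewrite adde_ge0 ?l1norm_ge0.
apply: (@le_trans _ _ (\sum_(0 <= i <oo) (`|u i j|%:E + `|v i j|%:E)%E)%E).
  apply: lee_nneseries => i _ *; first by rewrite lee_fin.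
  by rewrite -EFinD lee_fin suv.
rewrite nneseriesD; [|by move=> *; rewrite lee_fin..].
by apply: leeD; exact: le_l1norm.
Qed.

Lemma l1norm_fin x : (l1norm x < +oo)%E.
Proof. by have /asboolP[] := occ_valP x. Qed.

Lemma l1norm_sub_fin x y : l1norm (fun i j => x i j - y i j) \is a fin_num.
Proof.
rewrite ge0_fin_numE ?l1norm_ge0//.
apply: (@le_lt_trans _ _ (l1norm x + l1norm y)%E).
  by apply: l1norm_triangle => i j; exact: ler_normB.
by rewrite lte_add_pinfty ?l1norm_fin.
Qed.

Lemma l1distxx x : l1dist x x = 0.
Proof.
rewrite /l1dist (_ : l1norm _ = 0%E)//; apply/eqP; rewrite eq_le l1norm_ge0 andbT.
by apply: l1norm_le => // j; rewrite eseries0// => i _ _; rewrite subrr normr0.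
Qed.

Lemma l1dist_sym x y : l1dist x y = l1dist y x.
Proof.
rewrite /l1dist /l1norm; congr fine.
apply: eq_bigr => j _; apply: eq_eseriesr => i _.
by rewrite distrC.
Qed.

Lemma l1dist_positivity x y : l1dist x y = 0 -> x = y.
Proof.
move=> xy0; apply/val_inj/funext => i; apply/funext => j /=.
have n0 : l1norm (fun i j => x i j - y i j) = 0%E.
  by rewrite -(fineK (l1norm_sub_fin x y)) -/(l1dist x y) xy0.
apply/eqP; rewrite -subr_eq0 -normr_le0 -lee_fin -[leRHS]n0.
apply: le_trans (le_l1norm _ j) => /=.
apply: (@le_trans _ _ (\sum_(0 <= k < i.+1) `|x k j - y k j|%:E)%E).
  by rewrite big_nat_recr//= leeDr// sume_ge0// => k _; rewrite lee_fin.
by apply: nneseries_lim_ge => k _ _; rewrite lee_fin.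
Qed.

Lemma l1dist_triangle y x z : l1dist x z <= l1dist x y + l1dist y z.
Proof.
rewrite -lee_fin EFinD /l1dist !fineK ?l1norm_sub_fin//.
apply: l1norm_triangle => i j.
by rewrite (le_trans _ (ler_normD _ _))// addrA subrK.
Qed.

HB.instance Definition _ := @isMetric.Build R (occ_space R M) (@l1dist R M)
  l1distxx l1dist_positivity l1dist_sym l1dist_triangle.

End L1Metric.

(* [nu i] is the law of the i-th random element of T. *)
Definition tight (R : realType) (T : topologicalType) (I : Type) (D : set I)
    (nu : I -> set T -> \bar R) : Prop :=
  forall eps : R, 0 < eps ->
    exists K : set T, compact K /\ forall i, D i -> ((1 - eps)%:E <= nu i K)%E.

(* Vectors of queue lengths, with the discrete sigma-algebra. *)
Definition qstate (I : finType) : Type := {ffun I -> nat}.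

HB.instance Definition _ (I : finType) := Countable.on (qstate I).
HB.instance Definition _ (I : finType) :=
  isPointed.Build (qstate I) [ffun=> 0%N].
HB.instance Definition _ (I : finType) :=
  @isMeasurable.Build default_measure_display (qstate I)
    discrete_measurable discrete_measurable0
    discrete_measurableC discrete_measurableU.

Section SAJSQ.
Variables (R : realType) (M : nat).
Variables (mu gamma : 'I_M -> R) (lambda : R) (N : nat).

Definition admissible : Prop :=
  (0 < N)%N /\ forall j, exists2 n : nat, (0 < n)%N & N%:R * gamma j = n%:R.

(* For admissible N the truncation is exact: N gamma_j is an integer. *)
Definition nservers (j : 'I_M) : nat := Num.truncn (N%:R * gamma j).

(* A server is its type together with its number within the type. *)
Definition server : finType := {j : 'I_M & 'I_(nservers j)}.

Implicit Types (q : qstate server) (k l : server).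

Definition shortest q : {set server} :=
  [set k | [forall l, (q k <= q l)%N]]%SET.

(* The shortest queues of the fastest type (mu decreases with the type index)
   among those present: a job joins each with equal probability. *)
Definition sajsq_targets q : {set server} :=
  [set k in shortest q | [forall l in shortest q, (tag k <= tag l)%N]]%SET.

Definition arrival_rate q k : R :=
  if k \in sajsq_targets q then N%:R * lambda / #|sajsq_targets q|%:R else 0.

Definition service_rate q k : R := if (0 < q k)%N then mu (tag k) else 0.

Definition arrive q k : qstate server := [ffun l => (q l + (l == k))%N].
Definition depart q k : qstate server := [ffun l => (q l - (l == k))%N].

(* Arrivals are Poisson and job sizes exponential of mean 1, so the queue lengths
   form a continuous-time Markov chain: server k completes jobs at rate mu when
   busy, whatever the age of the job in service. *)
Definition generator (f : qstate server -> R) q : R :=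
  \sum_k arrival_rate q k * (f (arrive q k) - f q) +
  \sum_k service_rate q k * (f (depart q k) - f q).

Definition Qmatrix q q' : R := generator (fun p => (p == q')%:R) q.

(* At index i this is x_{i+1,j}: at least i+1 jobs means queue length > i. *)
Definition occ_fun q : nat -> 'I_M -> R := fun i j =>
  #|[set k : 'I_(nservers j) | (i < q (Tagged _ k))%N]%SET|%:R
    / (nservers j)%:R.

Lemma occ_fun_ge0 q i j : 0 <= occ_fun q i j.
Proof. by rewrite divr_ge0. Qed.

Lemma occ_fun_eq0 q i j : (\max_k q k <= i)%N -> occ_fun q i j = 0.
Proof.
move=> qi; rewrite /occ_fun (_ : [set _ | _]%SET = finset.set0) ?cards0 ?mul0r//.
apply/setP => k; rewrite !inE ltnNge; apply/negbTE; rewrite negbK.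
by apply: leq_trans qi; exact: leq_bigmax.
Qed.

Lemma occ_in_S q : in_S (occ_fun q).
Proof.
split=> [i j|].
  split; first exact: occ_fun_ge0.
  split.
    rewrite ler_wpM2r ?invr_ge0// ler_nat subset_leq_card//.
    by apply/fintype.subsetP => k; rewrite !inE; exact: ltnW.
  rewrite /occ_fun; set a := #|_|.
  have an : (a <= nservers j)%N by rewrite -[leqRHS]card_ord max_card.
  have [n0|n0] := posnP (nservers j); first by rewrite n0 invr0 mulr0.
  by rewrite ler_pdivrMr ?ltr0n// mul1r ler_nat.
rewrite /l1norm; apply/bigmax_ltP; split=> // j _.
rewrite (nneseries_split 0 (\max_k q k)); last by move=> *; rewrite lee_fin.
rewrite add0n [X in (_ + X)%E]eseries0; last first.
  by move=> i /= qi _; rewrite occ_fun_eq0// normr0.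
by rewrite adde0 sumEFin ltry.
Qed.

Definition occ q : occ_space R M := OccSpace (asboolT (occ_in_S q)).

End SAJSQ.

(* P is the (standard) transition function with Q-matrix Q, i.e. P'(0+) = Q. *)
Record transition_function (R : realType) (I : finType)
    (Q : qstate I -> qstate I -> R)
    (P : R -> R.-pker (qstate I) ~> (qstate I)) : Prop := {
  transition0 : forall q A, P 0 q A = \d_q A ;
  transitionD : forall s t, 0 <= s -> 0 <= t -> forall q A,
    P (s + t) q A = (\int[P s q]_p P t p A)%E ;
  transition_rate : forall q q',
    (fine (P h q [set q']) - (q == q')%:R) / h @[h --> 0^'+] --> Q q q'
}.

Definition occ_law (R : realType) (M : nat) (gamma : 'I_M -> R) (N : nat)
    (rho : probability (qstate (server gamma N)) R)
    (A : set (occ_space R M)) : \bar R :=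
  rho (@occ R M gamma N @^-1` A).

Definition occ_law_at (R : realType) (M : nat) (gamma : 'I_M -> R) (N : nat)
    (P : R -> R.-pker (qstate (server gamma N)) ~> (qstate (server gamma N)))
    (rho : probability (qstate (server gamma N)) R) (t : R)
    (A : set (occ_space R M)) : \bar R :=
  (\int[rho]_q P t q (@occ R M gamma N @^-1` A))%E.

(* The occupancy process x(t) is a function of the queue-length vector, so a law
   on S is stationary for it when it is [occ_law rho] for some initial law rho of
   the queue lengths under which the law of x(t) does not depend on t.  This
   holds in particular when rho itself is invariant for the queue lengths. *)
Definition occ_stationary (R : realType) (M : nat) (gamma : 'I_M -> R) (N : nat)
    (P : R -> R.-pker (qstate (server gamma N)) ~> (qstate (server gamma N)))
    (rho : probability (qstate (server gamma N)) R) : Prop :=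
  forall t, 0 <= t -> occ_law_at P rho t = occ_law rho.

(* Main.v *)
(* Since [\sum_k mu_k = N] and arrivals go to a shortest queue of length m,
   [N m^2 <= \sum_k mu_k q_k^2], so the drift of [V = \sum_k q_k^3] is at most
   [C N - c \sum_k q_k^2], with C and c > 0 not depending on N.  The generator is
   bounded, hence it integrates to zero against a stationary law on the bounded
   function [min V B] (a function of the occupancy); letting B grow gives
   [rho (\sum_k q_k^2 > b N) <= C / (c b)], uniformly in N.  On the complement
   [x_{i,j} = O(1 / i^2)], and arrays with this decay form an l1-compact set. *)
Require Import Defs.
From HB Require Import structures.
From mathcomp Require Import all_boot all_order all_algebra.
From mathcomp Require Import all_classical all_reals all_analysis.
From mathcomp Require Import ring lra zify.
Import Order.TTheory GRing.Theory Num.Theory.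
Import numFieldNormedType.Exports.
Local Open Scope classical_set_scope.
Local Open Scope ring_scope.

(** * Compactness in $\ell_1$ of arrays with quadratic decay *)

Section QuadraticDecay.
Context {R : realType} {M : nat}.
Variable B : R.
Hypothesis B_ge0 : 0 <= B.

(** The [i.+1] undoes the index shift: [x i j] is $x_{i+1,j}$, so the bound reads $B/i^2$ in the
    unshifted index. *)
Definition quadratic_decay : set (occ_space R M) :=
  [set x | forall i j, x i j <= B / i.+1%:R ^+ 2].

Lemma occ_ge0 (x : occ_space R M) i j : 0 <= x i j.
Proof.
by have /asboolP[H _] := occ_valP x; have [a [b c]] := H i j; apply: le_trans a b.
Qed.

(* Telescoping: [1 / i^2 <= 2 (1 / i - 1 / (i + 1))]. *)
Lemma sum_inv_sqr_le n m : (n <= m)%N ->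
  \sum_(n <= i < m) B / i.+1%:R ^+ 2 <= 2 * B / n.+1%:R.
Proof.
move=> nm; suff: \sum_(n <= i < m) B / i.+1%:R ^+ 2 <=
    2 * B / n.+1%:R - 2 * B / m.+1%:R.
  by move/le_trans; apply; rewrite gerBl divr_ge0 ?mulr_ge0.
elim: m nm => [|m IH]; first by rewrite leqn0 => /eqP ->; rewrite big_geq// subrr.
rewrite leq_eqVlt => /orP[/eqP<-|]; first by rewrite big_geq// subrr.
rewrite ltnS => nm; rewrite big_nat_recr//=.
apply: le_trans (lerD (IH nm) (lexx _)) _.
rewrite -subr_ge0.
have m1 : 0 < m.+1%:R :> R by [].
have -> : m.+2%:R = m.+1%:R + 1 :> R by rewrite -natr1.
set y := m.+1%:R in m1 *.
have y1 : 1 <= y by rewrite ler1n.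
rewrite (_ : _ - _ = B * (y - 1) / (y ^+ 2 * (y + 1))); last first.
  by field; rewrite !gt_eqF//; lra.
by rewrite divr_ge0 ?mulr_ge0 ?exprn_ge0//; lra.
Qed.

(** The cut [n] is free: [n = 0] gives a finite norm, while a large [n] makes the tail small
    uniformly over the whole set. *)
Lemma nneseries_tail_le (u : nat -> R) n :
  (forall i, 0 <= u i <= B / i.+1%:R ^+ 2) ->
  (\sum_(0 <= i <oo) (u i)%:E <= (\sum_(0 <= i < n) u i + 2 * B / n.+1%:R)%:E)%E.
Proof.
move=> uB; apply: lime_le.
  by apply: is_cvg_nneseries => i *; have /andP[] := uB i.
near=> m; have nm : (n <= m)%N by near: m; exact: nbhs_infty_ge.
rewrite sumEFin lee_fin (@big_cat_nat _ _ _ n)//= lerD2l.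
apply: le_trans (sum_inv_sqr_le _ _ nm).
by apply: ler_sum => i _; have /andP[] := uB i.
Unshelve. all: by end_near.
Qed.

(** Along an ultrafilter every coordinate converges, because it stays in a compact segment; the
    common summable bound then turns coordinatewise convergence into $\ell_1$ convergence. *)
Lemma quadratic_decay_compact : compact quadratic_decay.
Proof.
rewrite compact_ultra => F FU FK.
have FF : ProperFilter F by exact: ultra_proper.
pose b i : R := B / i.+1%:R ^+ 2.
have coord i j : exists l : R, (fun x : occ_space R M => x i j) @ F --> l.
  have := @segment_compact R 0 (b i); rewrite compact_ultra.
  move=> /(_ (fmap (fun x : occ_space R M => x i j) F)) cF.
  (* The image of an ultrafilter is an ultrafilter: for each [A], the preimage of [A] or its
     complement lies in [F]. *)
  have U : UltraFilter (fmap (fun x : occ_space R M => x i j) F).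
    split; first exact: fmap_proper_filter.
    move=> G GP FG; apply/funext => A; apply/propext; split; last exact: FG.
    move=> GA; have [//|FnA] :=
      in_ultra_setVsetC ((fun x : occ_space R M => x i j) @^-1` A) FU.
    exfalso; apply: (@filter_not_empty _ G GP); rewrite -(setICr A).
    by apply: filterI => //; exact: FG.
  have [|l [_ Fl]] := cF U; last by exists l.
  change (F [set x : occ_space R M | `[0, b i]%classic (x i j)]).
  apply: filterS FK => x xK; rewrite /= in_itv/=; apply/andP; split.
    exact: occ_ge0.
  exact: xK.
pose s i j := projT1 (cid (coord i j)).
have sP i j : (fun x : occ_space R M => x i j) @ F --> s i j :=
  projT2 (cid (coord i j)).
have s_ge0 i j : 0 <= s i j.
  by apply: (ler_cvg_to (cvg_cst 0) (sP i j)); apply: nearW => x; exact: occ_ge0.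
have s_le i j : s i j <= b i.
  by apply: (ler_cvg_to (sP i j) (cvg_cst (b i))); apply: filterS FK => x; exact.
have s_S : in_S s.
  split=> [i j|].
    have S x : in_S (occ_val x : nat -> 'I_M -> R) by exact/asboolP/occ_valP.
    split; first exact: s_ge0.
    split.
      apply: (ler_cvg_to (sP i.+1 j) (sP i j)); apply: nearW => x.
      by have [/(_ i j)[_ []]] := S x.
    apply: (ler_cvg_to (sP i j) (cvg_cst (1 : R))); apply: nearW => x.
    by have [/(_ i j)[_ []]] := S x.
  apply: (@le_lt_trans _ _ (2 * B / 1)%:E); last exact: ltry.
  apply: l1norm_le => [|j]; first by rewrite lee_fin divr_ge0 ?mulr_ge0.
  apply: le_trans (nneseries_tail_le (fun i => `|s i j|) 0 _) _.
    by move=> i; rewrite normr_ge0 (ger0_norm (s_ge0 i j)); exact: s_le.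
  by rewrite big_geq// add0r.
exists (OccSpace (asboolT s_S)); split; first exact: s_le.
apply/cvg_ballP => e e0; rewrite near_simpl.
(* Beyond [n] the tail costs less than [e / 2]; the [n] leading coordinates share the other
   [e / 2]. *)
have [n ne] : exists n : nat, 2 * B / n.+1%:R < e / 2.
  exists (Num.truncn ((e / 2)^-1 * (2 * B))).
  rewrite ltr_pdivrMr// -ltr_pdivrMl ?divr_gt0//.
  exact: truncnS_gt.
have nF : \forall x \near F, forall j : 'I_M, forall i : 'I_n,
    `|s i j - (x : occ_space R M) i j| < e / 2 / n.+1%:R.
  apply: filter_forall => j; apply: filter_forall => i.
  have /cvgrPdist_lt/(_ (e / 2 / n.+1%:R)) := sP i j.
  by apply; rewrite !divr_gt0.
near=> x.
have xK : quadratic_decay x by near: x.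
rewrite /ball/= /l1dist.
rewrite -lte_fin fineK; last exact: (l1norm_sub_fin (OccSpace (asboolT s_S)) x).
apply: (@le_lt_trans _ _ (e / 2 / n.+1%:R *+ n + 2 * B / n.+1%:R)%:E).
  apply: l1norm_le => [|j].
    by rewrite lee_fin addr_ge0 ?mulrn_wge0 ?divr_ge0 ?mulr_ge0// ltW.
  apply: le_trans (nneseries_tail_le (fun i => `|s i j - x i j|) n _) _.
    (* Both entries lie in [[0, b i]], so their difference obeys the same bound, without a factor
       2. *)
    move=> i; rewrite normr_ge0/= ler_norml lerBrDr lerBlDr.
    have := s_ge0 i j; have := s_le i j; have := occ_ge0 x i j; have := xK i j.
    by rewrite -/(b i); move=> *; apply/andP; split; lra.
  rewrite lee_fin lerD2r big_mkord -[X in _ *+ X]card_ord -sumr_const.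
  apply: ler_sum => i _; apply: ltW; move: j i; near: x; exact: nF.
rewrite lte_fin [ltRHS](splitr e); apply: ler_ltD => //.
rewrite -mulr_natr mulrAC ler_pdivrMr// ler_wpM2l//.
  by rewrite divr_ge0// ltW.
by rewrite ler_nat.
Unshelve. all: by end_near.
Qed.

End QuadraticDecay.

(** * Short-time behaviour of a transition function *)

Section TransitionFunctions.
Context {R : realType} {I : finType}.
Variables (Q : qstate I -> qstate I -> R).
Variables (P : R -> R.-pker (qstate I) ~> (qstate I)).
Hypothesis PQ : transition_function Q P.
Implicit Types (q x : qstate I) (A B : set (qstate I)) (h s t : R).

Definition trans h q A : R := fine (P h q A).

Lemma qstate_measurable A : measurable A. Proof. by []. Qed.

Hint Resolve qstate_measurable : core.

Lemma qstate_measurable_fun d (T : sigmaRingType d) A (f : qstate I -> T) :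
  measurable_fun A f.
Proof. by move=> mA Y mY; exact: qstate_measurable. Qed.

Lemma transT h q : trans h q setT = 1.
Proof. by rewrite /trans prob_kernel. Qed.

Lemma transE h q A : P h q A = (trans h q A)%:E.
Proof.
rewrite /trans fineK// ge0_fin_numE//.
apply: (@le_lt_trans _ _ (P h q setT)); last by rewrite prob_kernel ltry.
by apply: le_measure; rewrite ?inE.
Qed.

Lemma trans_ge0 h q A : 0 <= trans h q A.
Proof. by rewrite -lee_fin -transE. Qed.

Lemma transU h q A B : A `&` B = set0 ->
  trans h q (A `|` B) = trans h q A + trans h q B.
Proof.
by move=> AB; apply/EFin_inj; rewrite EFinD -!transE measureU.
Qed.

Lemma trans_le h q A B : A `<=` B -> trans h q A <= trans h q B.
Proof. by move=> AB; rewrite -lee_fin -!transE le_measure ?inE. Qed.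

Lemma transC h q A : trans h q (~` A) = 1 - trans h q A.
Proof. by rewrite -(transT h q) -(setUv A) transU ?setICr// addrC addKr. Qed.

(** Only an inequality, as [A] may contain states outside [r]; used for [A] and for its complement,
    it encloses [trans h q A] from both sides. *)
Lemma trans_ge_sum h q (r : seq (qstate I)) A : uniq r ->
  \sum_(x <- r | x \in A) trans h q [set x] <= trans h q A.
Proof.
elim: r A => [|x r IH] A /=; first by rewrite big_nil trans_ge0.
move=> /andP[xr ur]; rewrite big_cons; case: ifPn => [xA|_]; last exact: IH.
have -> : trans h q A = trans h q [set x] + trans h q (A `\ x).
  rewrite -transU ?setDUK//; first by move=> y ->; rewrite inE in xA.
  by rewrite setDE setIC -setIA setICl setI0.
rewrite lerD2l; apply: le_trans (IH _ ur); rewrite le_eqVlt; apply/orP; left.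
rewrite big_seq_cond [X in _ == X]big_seq_cond; apply/eqP/eq_bigl => y.
case: (boolP (y \in r)) => //= yr.
rewrite in_setD in_set1; case: eqVneq => [yx|_]; last by rewrite andbT.
by rewrite -yx yr in xr.
Qed.

(** Being at [q] at time [s] and again at [s + t] is one way of being there at [s + t]
    (Chapman-Kolmogorov). *)
Lemma trans_diag_mul s t q : 0 <= s -> 0 <= t ->
  trans s q [set q] * trans t q [set q] <= trans (s + t) q [set q].
Proof.
move=> s0 t0; rewrite -lee_fin EFinM -!transE (transitionD PQ)//.
apply: (@le_trans _ _ (\int[P s q]_(x in [set q]) P t x [set q])%E); last first.
  by apply: ge0_subset_integral => //; exact: qstate_measurable_fun.
rewrite (@eq_integral _ _ _ _ _ (cst (P t q [set q]))); last first.
  by move=> x; rewrite inE /= => ->.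
by rewrite integral_cst// muleC.
Qed.

Lemma trans_diag_le1 h q : trans h q [set q] <= 1.
Proof. by rewrite -(transT h q) trans_le. Qed.

(** Induction with [trans_diag_mul] and $1 - ab \le (1 - a) + (1 - b)$ for $a, b \in [0, 1]$. *)
Lemma trans_leave_natmul h q n : 0 <= h ->
  1 - trans (n.+1%:R * h) q [set q] <= n.+1%:R * (1 - trans h q [set q]).
Proof.
move=> h0; elim: n => [|n IH]; first by rewrite !mul1r.
have := trans_diag_mul (n.+1%:R * h) h q (mulr_ge0 (ler0n _ _) h0) h0.
rewrite -[X in trans (_ + X)](mul1r h) -mulrDl natr1.
have := trans_diag_le1 (n.+1%:R * h) q; have := trans_diag_le1 h q.
have := trans_ge0 (n.+1%:R * h) q [set q]; have := trans_ge0 h q [set q].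
have -> : n.+2%:R = n.+1%:R + 1 :> R by rewrite natr1.
set a := trans (n.+1%:R * h) _ _ in IH *; set b := trans h _ _ in IH *.
move=> a0 b0 a1 b1 ab; nra.
Qed.

(* The exit probability is subadditive in time, so its slope at 0 bounds it. *)
Lemma trans_leave_le h q : 0 <= h -> 1 - trans h q [set q] <= - Q q q * h.
Proof.
rewrite le_eqVlt => /orP[/eqP<-|h0].
  by rewrite mulr0 /trans (transition0 PQ) diracE mem_set// subrr.
(* At time [h / n.+1], the exit probability multiplied by [n.+1] is [h] times a difference quotient,
   whose limit is [- Q q q]. *)
have /cvg_at_rightP/(_ (fun n => h / n.+1%:R)) :=
  transition_rate PQ (q := q) (q' := q).
have uh : (forall n : nat, 0 < h / n.+1%:R) /\
    h / n.+1%:R @[n --> \oo] --> (0 : R).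
  split=> [n|]; first by rewrite divr_gt0.
  rewrite -[X in _ --> X](mulr0 h).
  by apply: cvgM; [exact: cvg_cst|exact: cvg_harmonic].
move=> /(_ uh) /cvgN cN; have cQ := cvgM cN (cvg_cst h).
have cc : (fun _ : nat => 1 - trans h q [set q]) @ \oo --> 1 - trans h q [set q].
  exact: cvg_cst.
apply: (ler_cvg_to cc (cQ _ _)).
apply: nearW => n; rewrite /= eqxx -/(trans _ _ _).
have := trans_leave_natmul (h / n.+1%:R) q n (ltW (uh.1 n)).
rewrite mulrCA divff ?pnatr_eq0// mulr1 => /le_trans; apply.
rewrite le_eqVlt; apply/orP; left; apply/eqP.
rewrite fctE /trans -[true%:R]/(1 : R).
by field; rewrite ?gt_eqF.
Qed.

(** Membership in [A] can change only if the state does. Linear in [h], the bound dominates the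
    difference quotients in [stationary_flow]. *)
Lemma trans_indic_le h q A : 0 <= h ->
  `|trans h q A - \1_A q| <= - Q q q * h.
Proof.
move=> h0; apply: le_trans (trans_leave_le h q h0).
rewrite indicE; case: (boolP (q \in A)) => qA.
  rewrite distrC ger0_norm; last by rewrite subr_ge0 -(transT h q) trans_le.
  by rewrite lerD2l lerN2 trans_le// => x ->; rewrite inE in qA.
rewrite subr0 ger0_norm ?trans_ge0// -transC trans_le// => x Ax /= xq.
by move: qA; rewrite -xq mem_set.
Qed.

(** Rates are given state by state while [A] may be infinite. Finite sums over [r] bound the
    quotient from below through [A] and from above through its complement; the zero row sum makes
    the two limits agree. *)
Lemma trans_indic_cvg q A (r : seq (qstate I)) : uniq r -> q \in r ->
  \sum_(x <- r) Q q x = 0 ->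
  (trans h q A - \1_A q) / h @[h --> 0^'+] --> \sum_(x <- r | x \in A) Q q x.
Proof.
move=> ur qr Q0.
have cB B : \sum_(x <- r | x \in B) (trans h q [set x] - (q == x)%:R) / h
    @[h --> 0^'+] --> \sum_(x <- r | x \in B) Q q x.
  apply: cvg_big => [|x _]; first exact: add_continuous.
  exact: (transition_rate PQ).
have dB B : \sum_(x <- r | x \in B) (q == x)%:R = \1_B q :> R.
  rewrite big_mkcond (bigD1_seq q)//= eqxx big1 ?addr0 => [|x xq].
    by rewrite indicE; case: ifP.
  by rewrite eq_sym (negPf xq); case: ifP.
apply: (@squeeze_cvgr _ _ _ _
  (fun h => \sum_(x <- r | x \in A) (trans h q [set x] - (q == x)%:R) / h)
  (fun h => - \sum_(x <- r | x \in ~` A) (trans h q [set x] - (q == x)%:R) / h)).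
- near=> h.
  have h0 : 0 < h by near: h; exact: nbhs_right_gt.
  rewrite -!mulr_suml -mulNr !ler_pM2r ?invr_gt0// !sumrB !dB.
  rewrite lerD2r trans_ge_sum//=.
  have := trans_ge_sum h q r (~` A) ur; rewrite transC.
  have : \1_(~` A) q = 1 - \1_A q :> R.
    by rewrite !indicE in_setC; case: (q \in A) => /=; rewrite ?subrr ?subr0.
  move=> ->; lra.
- exact: cB.
- have -> : \sum_(x <- r | x \in A) Q q x = - \sum_(x <- r | x \in ~` A) Q q x.
    apply/eqP; rewrite -addr_eq0 -[X in _ == X]Q0 [X in _ == X](bigID (mem A))/=.
    apply/eqP; congr (_ + _); apply: eq_bigl => x; exact: in_setC.
  by apply: cvgN; exact: cB.
Unshelve. all: by end_near.
Qed.

(** * Differentiating at time 0 under a stationary law *)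

Section StationarySets.
Variables (rho : probability (qstate I) R) (Lam : R).
Hypothesis Lam_ge : forall q, - Q q q <= Lam.

Lemma bounded_integrable (f : qstate I -> R) (c : R) :
  (forall q, `|f q| <= c) -> rho.-integrable setT (EFin \o f).
Proof.
move=> fc; apply: measurable_bounded_integrable => //.
- apply: (le_lt_trans (probability_le1 rho (qstate_measurable _))); exact: ltry.
- exists c; split; first exact: num_real.
  by move=> y cy x _; apply: le_trans (fc x) (ltW cy).
Qed.

(** Invariance makes every difference quotient integrate to zero, and the uniform exit rate [Lam]
    allows dominated convergence. Invariance is asked of the single set [A] because the law [rho] is
    only known to be stationary on occupancy events. *)
Lemma stationary_flow A (LA : qstate I -> R) :
  (forall t, 0 <= t -> (\int[rho]_q P t q A)%E = rho A) ->
  (forall q, (trans h q A - \1_A q) / h @[h --> 0^'+] --> LA q) ->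
  rho.-integrable setT (EFin \o LA) /\ (\int[rho]_q (LA q)%:E = 0)%E.
Proof.
move=> Ast cL.
pose f n q : R := (trans (n.+1%:R^-1) q A - \1_A q) / n.+1%:R^-1.
have n0 n : 0 < n.+1%:R^-1 :> R by rewrite invr_gt0.
have [] := @dominated_convergence _ _ _ rho setT (qstate_measurable _)
   (fun n q => (f n q)%:E) (EFin \o LA) (cst Lam%:E).
- by move=> n; exact: qstate_measurable_fun.
- exact: qstate_measurable_fun.
- apply: aeW => q _; apply: cvg_EFin; first exact: nearW.
  have /cvg_at_rightP/(_ (fun n => n.+1%:R^-1)) := cL q; apply; split => //.
  exact: cvg_harmonic.
- apply: (bounded_integrable (cst Lam) `|Lam|) => q; exact: lexx.
- apply: aeW => q n _; rewrite lee_fin normrM normfV (gtr0_norm (n0 n)).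
  rewrite ler_pdivrMr//; apply: le_trans (trans_indic_le _ _ _ (ltW (n0 n))) _.
  by rewrite ler_wpM2r// ltW.
move=> iL _ cI; split => //.
have f0 : (fun n => \int[rho]_q (f n q)%:E)%E = cst 0%E; last first.
  by apply: (cvg_unique _ cI) => //; rewrite f0; exact: cvg_cst.
apply/funext => n /=.
under eq_integral do rewrite /f mulrC EFinM EFinB.
have i1 : rho.-integrable setT (EFin \o (fun q => trans (n.+1%:R^-1) q A)).
  apply: (bounded_integrable _ 1) => q; rewrite ger0_norm ?trans_ge0//.
  by rewrite -[leRHS](transT n.+1%:R^-1 q) trans_le.
have i2 : rho.-integrable setT (EFin \o \1_A).
  apply: (bounded_integrable _ 1) => q.
  by rewrite indicE; case: (_ \in _); rewrite ?normr1 ?normr0.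
rewrite integralZl//; last first.
  have := integrableB (qstate_measurable _) i1 i2; apply: eq_integrable => // q _.
rewrite integralB_EFin// integral_indic// setIT.
under eq_integral do rewrite -transE.
rewrite Ast ?ltW// subee ?mule0//.
exact: fin_num_measure.
Qed.

End StationarySets.
End TransitionFunctions.

(** Discrete layer-cake formula; the common cap [L] lets all servers share one range of levels. *)
Lemma sum_layers {R : realType} (F : nat -> R) (x L : nat) : (x <= L)%N ->
  F x = F 0%N + \sum_(i < L) (i < x)%:R * (F i.+1 - F i).
Proof.
move=> xL; rewrite -(big_mkord xpredT (fun i => (i < x)%:R * (F i.+1 - F i))).
rewrite (@big_cat_nat _ _ _ x)//= [X in _ + (_ + X)]big1_seq ?addr0; last first.
  move=> i /andP[_]; rewrite mem_index_iota => /andP[xi _].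
  by rewrite ltnNge xi mul0r.
rewrite (eq_big_nat _ _ (F2 := fun i => F i.+1 - F i)) => [|i /andP[_ ->]];
  last by rewrite mul1r.
by rewrite telescope_sumr// addrC subrK.
Qed.

Lemma finite_pos_lower_bound {R : realType} (M : nat) (f : 'I_M -> R) :
  (forall j, 0 < f j) -> exists2 c, 0 < c & forall j, c <= f j.
Proof.
(* The starting value 1 only caps the minimum, which therefore stays positive. *)
move=> f0; exists (\big[Num.min/1]_j f j); first exact/lt_bigmin.
by move=> j; exact: bigmin_le.
Qed.

(** * Rates of SA-JSQ and its generator as a finite sum *)

Section Lyapunov.
Context {R : realType} {M : nat}.
Variables (mu gamma : 'I_M -> R) (lambda : R) (N : nat).
Hypothesis mu_gt0 : forall j, 0 < mu j.
Hypothesis gamma_mu_sum : \sum_(j < M) gamma j * mu j = 1.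
Hypothesis lambda_gt0 : 0 < lambda.
Hypothesis lambda_lt1 : lambda < 1.
Hypothesis admN : admissible gamma N.

Local Notation state := (qstate (server gamma N)).
Local Notation gen := (@generator R M mu gamma lambda N).
Local Notation arr := (@arrival_rate R M gamma lambda N).
Local Notation srv := (@service_rate R M mu gamma N).
Local Notation nth_server j i :=
  (@Tagged 'I_M j (fun j => 'I_(nservers gamma N j)) i : server gamma N).
Implicit Types (q : state) (k l : server gamma N) (f g : state -> R).

Lemma nserversE j : (nservers gamma N j)%:R = N%:R * gamma j.
Proof. by have [_ /(_ j)[n _ e]] := admN; rewrite /nservers e natrK. Qed.

Lemma nservers_gt0 j : (0 < nservers gamma N j)%N.
Proof. by have [_ /(_ j)[n n0 e]] := admN; rewrite /nservers e natrK. Qed.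

Lemma sum_server (F : server gamma N -> R) :
  \sum_k F k = \sum_(j < M) \sum_(i < nservers gamma N j) F (nth_server j i).
Proof.
rewrite (sig_big_dep (fun=> true) (fun _ _ => true)
  (fun j i => F (nth_server j i))).
by apply: eq_bigr => -[].
Qed.

(** The total service capacity is $N$, so the [mu (tag k) / N] are averaging weights in the drift
    estimate. *)
Lemma sum_mu : \sum_(k : server gamma N) mu (tag k) = N%:R.
Proof.
transitivity (N%:R * \sum_(j < M) gamma j * mu j); last first.
  by rewrite gamma_mu_sum mulr1.
rewrite sum_server/= mulr_sumr.
apply: eq_bigr => j _.
by rewrite sumr_const card_ord -[LHS]mulr_natl nserversE mulrA.
Qed.

Lemma arrival_ge0 q k : 0 <= arr q k.
Proof.
rewrite /arrival_rate; case: ifP => // _.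
by rewrite !mulr_ge0 ?invr_ge0// ltW.
Qed.

Lemma service_ge0 q k : 0 <= srv q k.
Proof. by rewrite /service_rate; case: ifP => // _; exact: ltW. Qed.

Lemma sum_arrival_le q : \sum_k arr q k <= N%:R * lambda.
Proof.
rewrite -big_mkcond/= sumr_const -[X in X <= _]mulr_natr.
have [->|n0] := posnP #|sajsq_targets q|; first by rewrite mulr0 mulr_ge0// ltW.
by rewrite divfK// pnatr_eq0 -lt0n.
Qed.

Lemma arrival_shortest q k l : arr q k != 0 -> (q k <= q l)%N.
Proof.
rewrite /arrival_rate; case: ifP => [|_]; last by rewrite eqxx.
by rewrite !inE => /andP[/forallP/(_ l)].
Qed.

(** At most the total arrival rate plus the full service capacity: a bound uniform in [q], which
    serves as [Lam]. *)
Lemma exit_rate_le q :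
  - @Qmatrix R M mu gamma lambda N q q <= N%:R * lambda + N%:R.
Proof.
rewrite /Qmatrix /generator eqxx opprD -!sumrN; apply: lerD.
  apply: le_trans (sum_arrival_le q); apply: ler_sum => k _.
  have := arrival_ge0 q k; case: (arrive q k == q) => /=; lra.
rewrite -[leRHS]sum_mu; apply: ler_sum => k _.
have := mu_gt0 (tag k); rewrite /service_rate.
by case: ifP => _; case: (depart q k == q) => /=; lra.
Qed.

(** A finite support for row [q] of the Q-matrix. Duplicates do occur: [depart] at an empty queue
    returns [q]. *)
Definition neighbours q : seq state :=
  undup (q :: [seq arrive q k | k <- enum (server gamma N)] ++
              [seq depart q k | k <- enum (server gamma N)]).

Lemma mem_neighbours q : q \in neighbours q.
Proof. by rewrite mem_undup mem_head. Qed.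

Lemma arrive_neighbours q k : arrive q k \in neighbours q.
Proof. by rewrite mem_undup inE mem_cat map_f ?mem_enum ?orbT. Qed.

Lemma depart_neighbours q k : depart q k \in neighbours q.
Proof. by rewrite mem_undup inE mem_cat (map_f (depart q)) ?mem_enum ?orbT. Qed.

Lemma sum_neighbours q g :
  \sum_(x <- neighbours q) g x * @Qmatrix R M mu gamma lambda N q x = gen g q.
Proof.
have pt y : y \in neighbours q ->
    \sum_(x <- neighbours q) g x * (y == x)%:R = g y.
  move=> yn; rewrite (bigD1_seq y) ?undup_uniq//= eqxx mulr1.
  rewrite big1 ?addr0// => x xy.
  by rewrite eq_sym (negPf xy) mulr0.
rewrite /Qmatrix /generator.
under eq_bigr do rewrite mulrDr !mulr_sumr.
rewrite big_split/=; congr (_ + _); rewrite exchange_big/=; apply: eq_bigr => k _.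
  under eq_bigr do rewrite mulrCA mulrBr.
  by rewrite -mulr_sumr sumrB !pt ?arrive_neighbours ?mem_neighbours.
under eq_bigr do rewrite mulrCA mulrBr.
by rewrite -mulr_sumr sumrB !pt ?depart_neighbours ?mem_neighbours.
Qed.

(** * The cubic Lyapunov function and its drift *)

Definition cubes q : nat := \sum_k q k ^ 3.
Definition squares q : nat := \sum_k q k ^ 2.

Lemma cubesE q L : (forall k, q k <= L)%N -> (cubes q)%:R =
  \sum_(i < L) (i.+1%:R ^+ 3 - i%:R ^+ 3) *
    \sum_(j < M) (nservers gamma N j)%:R * occ_fun q i j.
Proof.
move=> qL; rewrite natr_sum.
under eq_bigr do
  rewrite natrX (sum_layers (fun x => x%:R ^+ 3) _ _ (qL _)) expr0n add0r.
rewrite exchange_big/=; apply: eq_bigr => i _.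
rewrite -mulr_suml mulrC; congr (_ * _).
rewrite sum_server; apply: eq_bigr => j _ /=.
rewrite /occ_fun mulrCA divff ?mulr1 ?pnatr_eq0 -?lt0n ?nservers_gt0//.
by rewrite -natr_sum -sum1dep_card -big_mkcond/=.
Qed.

(** By [cubesE] the sum of cubes is read off the occupancy, which is what makes occupancy
    stationarity applicable to it. *)
Lemma cubes_occ q q' : occ q = occ q' -> cubes q = cubes q'.
Proof.
move=> /(congr1 (@occ_val R M))/= qq'; apply/eqP; rewrite -(eqr_nat R); apply/eqP.
pose L := maxn (\max_k q k) (\max_k q' k).
rewrite (cubesE q L) => [|k]; last by rewrite leq_max leq_bigmax.
rewrite (cubesE q' L) => [|k]; last by rewrite leq_max leq_bigmax orbT.
by rewrite qq'.
Qed.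

Lemma cubes_arrive q k : (cubes (arrive q k))%:R - (cubes q)%:R =
  3 * (q k)%:R ^+ 2 + 3 * (q k)%:R + 1 :> R.
Proof.
rewrite /cubes (bigD1 k)//= [X in _ - (X)%:R](bigD1 k)//= ffunE eqxx addn1.
rewrite (eq_bigr (fun l => q l ^ 3)%N) => [|l /negPf lk]; last first.
  by rewrite ffunE lk addn0.
rewrite !natrD !natrX -[(q k).+1%:R]natr1; ring.
Qed.

Lemma cubes_depart q k : (0 < q k)%N ->
  (cubes (depart q k))%:R - (cubes q)%:R =
  - 3 * (q k)%:R ^+ 2 + 3 * (q k)%:R - 1 :> R.
Proof.
move=> qk; rewrite /cubes (bigD1 k)//= [X in _ - (X)%:R](bigD1 k)//= ffunE eqxx.
rewrite (eq_bigr (fun l => q l ^ 3)%N) => [|l /negPf lk]; last first.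
  by rewrite ffunE lk subn0.
rewrite !natrD !natrX natrB//= -[true%:R]/(1 : R); ring.
Qed.

Let a := 1 - lambda.

Lemma a_gt0 : 0 < a. Proof. by rewrite subr_gt0. Qed.

(** A target is a shortest queue, so its increment is at most that of any server, hence at most the
    average [T / N] with weights [mu (tag l) / N]; the total arrival rate is at most $N\lambda$. *)
Lemma arrival_drift_le q :
  \sum_k arr q k * (3 * (q k)%:R ^+ 2 + 3 * (q k)%:R + 1) <=
  lambda * \sum_k mu (tag k) * (3 * (q k)%:R ^+ 2 + 3 * (q k)%:R + 1).
Proof.
have N0 : 0 < N%:R :> R by rewrite ltr0n; have [] := admN.
set T := \sum_(k : server gamma N) mu (tag k) * _.
have T0 : 0 <= T.
  apply: sumr_ge0 => k _.
  by rewrite mulr_ge0 ?(ltW (mu_gt0 _))// !addr_ge0 ?mulr_ge0.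
apply: (@le_trans _ _ (\sum_k arr q k * (T / N%:R))).
  apply: ler_sum => k _; have [->|ak] := eqVneq (arr q k) 0.
    by rewrite !mul0r.
  rewrite ler_wpM2l ?arrival_ge0// ler_pdivlMr// -sum_mu mulr_sumr.
  apply: ler_sum => l _; rewrite mulrC ler_wpM2l ?(ltW (mu_gt0 _))//.
  have qkl := arrival_shortest q k l ak.
  rewrite lerD2r; apply: lerD; rewrite ler_wpM2l//; last by rewrite ler_nat.
  by rewrite -!natrX ler_nat leq_exp2r.
rewrite -mulr_suml; apply: le_trans (ler_wpM2r _ (sum_arrival_le q)) _.
  by rewrite divr_ge0.
by rewrite mulrAC mulrCA divff ?gt_eqF// mulr1 mulrC.
Qed.

(** [6 / a] absorbs the linear term of the drift by AM-GM, and [1] covers the arrival share of an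
    idle server; neither depends on [N]. *)
Definition drift_const : R := 6 / a + 1.

(** With $N = \sum_k \mu_k$ the comparison is made server by server. For a busy server of length $x$
    the terms of degree 2 and 1 are $-3ax^2 + (6 - 3a)x$; half of the square absorbs $6x$ and half
    remains. *)
Lemma drift_le q :
  \sum_k arr q k * ((cubes (arrive q k))%:R - (cubes q)%:R) +
  \sum_k srv q k * ((cubes (depart q k))%:R - (cubes q)%:R) <=
  N%:R * drift_const - 3 / 2 * a * \sum_k mu (tag k) * (q k)%:R ^+ 2.
Proof.
under eq_bigr do rewrite cubes_arrive.
apply: le_trans (lerD (arrival_drift_le q) (lexx _)) _.
rewrite -sum_mu mulr_suml !mulr_sumr -big_split/= -sumrB.
apply: ler_sum => k _; rewrite /service_rate.
have m0 := mu_gt0 (tag k); have a0 := a_gt0.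
(* AM-GM: [6 x <= 3/2 a x^2 + 6 / a] *)
have amgm : 6 * (q k)%:R <= 3 / 2 * a * (q k)%:R ^+ 2 + 6 / a.
  rewrite -subr_ge0 (_ : _ - _ = 3 / 2 * a * ((q k)%:R - 2 / a) ^+ 2).
    by rewrite mulr_ge0 ?sqr_ge0//; lra.
  by field; rewrite gt_eqF.
have [qk|] := ltnP 0 (q k).
  rewrite cubes_depart// /drift_const.
  set x := (q k)%:R in amgm *; set m := mu _ in m0 *.
  rewrite -subr_ge0.
  have -> : m * (6 / a + 1) - 3 / 2 * a * (m * x ^+ 2) -
    (lambda * (m * (3 * x ^+ 2 + 3 * x + 1)) + m * (- 3 * x ^+ 2 + 3 * x - 1)) =
    m * ((3 / 2 * a * x ^+ 2 + 6 / a - 6 * x) + 3 * a * x + (1 + a)).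
    by rewrite (_ : lambda = 1 - a); [field; rewrite gt_eqF|rewrite /a; ring].
  apply: mulr_ge0; first exact: ltW.
  have ax : 0 <= 3 * a * x by rewrite !mulr_ge0// ltW.
  lra.
(* An idle server has no departure; its arrival share is $\lambda\mu_k \le \mu_k$. *)
rewrite leqn0 => /eqP ->; rewrite mul0r mulr0n /drift_const expr0n/=
  !mulr0 !add0r !addr0 mulr1 subr0.
have ia : 0 < 6 / a by rewrite divr_gt0.
have := mulr_gt0 m0 ia; rewrite mulrDr mulr1; 
have := ler_wpM2r (ltW m0) (ltW lambda_lt1); rewrite mul1r.
set y := _ * (6 / a) => lm y0. lra.
Qed.

(* [min cubes B] is bounded, and concave in [cubes], so that its drift is at most
   that of [cubes] below the level B and nonpositive above it. *)
Lemma truncated_drift_le (mu0 b : R) (B : nat) q : 0 < mu0 -> 0 <= b ->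
  (forall j, mu0 <= mu j) ->
  gen (fun x => (minn (cubes x) B)%:R) q <=
  N%:R * drift_const - 3 / 2 * a * mu0 * b * N%:R *
    \1_[set x | (b * N%:R < (squares x)%:R) && (cubes x < B)%N] q.
Proof.
move=> mu00 b0 mu0P; have a0 := a_gt0; rewrite indicE.
have D0 : 0 <= N%:R * drift_const by rewrite mulr_ge0// addr_ge0// divr_ge0// ltW.
have [VB|VB] := leqP B (cubes q).
  rewrite memNset/= ?mulr0 ?subr0; last by rewrite ltnNge VB andbF.
  apply: le_trans D0; rewrite /generator -[leRHS]addr0.
  apply: lerD; apply: sumr_le0 => k _;
    rewrite mulr_ge0_le0 ?arrival_ge0 ?service_ge0//;
    by rewrite (minn_idPr VB) subr_le0 ler_nat geq_minr.
apply: (@le_trans _ _ (N%:R * drift_const - 3 / 2 * a * (mu0 * (squares q)%:R))).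
  apply: (@le_trans _ _ (N%:R * drift_const -
      3 / 2 * a * \sum_k mu (tag k) * (q k)%:R ^+ 2)).
    apply: le_trans (drift_le q); rewrite /generator (minn_idPl (ltnW VB)).
    by apply: lerD; apply: ler_sum => k _;
      rewrite ler_wpM2l ?arrival_ge0 ?service_ge0//
      lerD2r ler_nat geq_minl.
  rewrite lerD2l lerN2 ler_wpM2l//; first by rewrite mulr_ge0 ?ltW.
  rewrite natr_sum mulr_sumr; apply: ler_sum => k _.
  by rewrite natrX ler_wpM2r ?exprn_ge0.
rewrite lerD2l lerN2; case: (boolP (q \in _)) => [|_].
  rewrite inE/= => /andP[/ltW bW _]; rewrite mulr1 -!mulrA.
  by rewrite !ler_wpM2l ?divr_ge0// ltW.
by rewrite mulr0 !mulr_ge0// ?(ltW a0) ?(ltW mu00).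
Qed.

Lemma generator_sum (J : finType) (F : J -> state -> R) q :
  gen (fun x => \sum_j F j x) q = \sum_j gen (F j) q.
Proof.
rewrite /generator big_split/=; congr (_ + _); rewrite exchange_big/=;
  by apply: eq_bigr => k _; rewrite -sumrB mulr_sumr.
Qed.

(** * Tail of the sum of squares under a stationary law *)

Variables (P : R -> R.-pker state ~> state) (rho : probability state R).
Hypothesis PQ : transition_function (@Qmatrix R M mu gamma lambda N) P.
Hypothesis rho_st : occ_stationary P rho.

(** By [cubes_occ] the event is the preimage under [occ] of its own image, so stationarity of the
    occupancy law applies. *)
Lemma stationary_cubes m t : 0 <= t ->
  (\int[rho]_q P t q [set x | (m < cubes x)%N] = rho [set x | (m < cubes x)%N])%E.
Proof.
move=> t0; set A := [set x : state | _].
have -> : A = @occ R M gamma N @^-1` (@occ R M gamma N @` A).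
  apply/seteqP; split => [x Ax|x [y Ay yx]]; first by exists x.
  by rewrite /A/= -(cubes_occ _ _ yx).
by have := rho_st t t0 => /(congr1 (fun law => law (@occ R M gamma N @` A))).
Qed.

Lemma stationary_generator m :
  rho.-integrable setT (EFin \o gen \1_[set x | (m < cubes x)%N]) /\
  (\int[rho]_q (gen \1_[set x | (m < cubes x)%N] q)%:E = 0)%E.
Proof.
apply: (stationary_flow _ _ PQ rho _ exit_rate_le); first exact: stationary_cubes.
move=> q; set A := [set x | _].
have -> : gen \1_A q =
    \sum_(x <- neighbours q | x \in A) @Qmatrix R M mu gamma lambda N q x.
  rewrite -sum_neighbours [RHS]big_mkcond; apply: eq_bigr => x _.
  by rewrite indicE mulr_natl mulrb.
apply: (trans_indic_cvg _ _ PQ); [exact: undup_uniq|exact: mem_neighbours|].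
(* The zero row sum is the fact that the generator kills constants. *)
transitivity (gen (cst 1) q).
  by rewrite -sum_neighbours; apply: eq_bigr => x _; rewrite mul1r.
by rewrite /generator !big1 ?addr0// => k _; rewrite subrr mulr0.
Qed.

(** Since $\min(V, B) = \sum_{m < B} 1_{m < V}$, the identity follows by linearity from the one for
    events. *)
Lemma stationary_truncated B :
  rho.-integrable setT (EFin \o gen (fun x => (minn (cubes x) B)%:R)) /\
  (\int[rho]_q (gen (fun x => (minn (cubes x) B)%:R) q)%:E = 0)%E.
Proof.
have -> : gen (fun x => (minn (cubes x) B)%:R) =
    fun q => \sum_(m < B) gen \1_[set x | (m < cubes x)%N] q.
  apply/funext => q; rewrite -generator_sum; congr (gen _ q); apply/funext => x.
  transitivity (\sum_(m < B) (m < cubes x)%:R : R); last first.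
    by apply: eq_bigr => m _; rewrite indicE mem_setE.
  rewrite -natr_sum; congr _%:R; elim: B => [|B IH].
    by rewrite big_ord0 minn0.
  by rewrite big_ord_recr/= -IH; lia.
split.
  rewrite (_ : _ \o _ =
      fun q => (\sum_(m < B) (gen \1_[set x | (m < cubes x)%N] q)%:E)%E).
    by apply: integrable_sum => // m _; exact: (stationary_generator m).1.
  by apply/funext => q /=; rewrite sumEFin.
under eq_integral do rewrite -sumEFin.
rewrite integral_sum//; last by move=> m; exact: (stationary_generator m).1.
by rewrite big1// => m _; exact: (stationary_generator m).2.
Qed.

(** Integrating [truncated_drift_le] against [rho] gives $0 \le N C - c N \rho(D)$, where [C] is
    [drift_const]; the factor $N$ cancels, hence the uniformity. *)
Lemma truncated_tail_le (mu0 b : R) (B : nat) : 0 < mu0 -> 0 < b ->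
  (forall j, mu0 <= mu j) ->
  (rho [set x | (b * N%:R < (squares x)%:R)%R && (cubes x < B)%N] <=
   (drift_const / (3 / 2 * a * mu0 * b))%:E)%E.
Proof.
move=> mu00 b0 mu0P; set D := [set x | _]; have a0 := a_gt0.
have N0 : 0 < N%:R :> R by rewrite ltr0n; have [] := admN.
set c := 3 / 2 * a * mu0 * b.
have c0 : 0 < c by rewrite !mulr_gt0.
have rD : rho D = (fine (rho D))%:E by rewrite fineK// fin_num_measure.
have i1 : rho.-integrable setT (EFin \o cst (N%:R * drift_const)).
  by apply: (bounded_integrable rho _ `|N%:R * drift_const|).
have i2 : rho.-integrable setT (EFin \o (fun x => c * N%:R * \1_D x)).
  apply: (bounded_integrable rho _ `|c * N%:R|) => q.
  by rewrite normrM ler_piMr// indicE; case: (_ \in _); rewrite ?normr1 ?normr0.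
have [iG G0] := stationary_truncated B.
have : (\int[rho]_q (gen (fun x => (minn (cubes x) B)%:R) q)%:E <=
    \int[rho]_q ((N%:R * drift_const)%:E - (c * N%:R * \1_D q)%:E))%E.
  apply: le_integral => //; first exact: integrableB.
  by move=> q _; rewrite -EFinB lee_fin; exact: truncated_drift_le (ltW b0) _.
rewrite G0 integralB_EFin//.
under [X in (_ <= _ - X)%E]eq_integral do rewrite EFinM.
rewrite integral_cst// integralZl//; last first.
  apply: (bounded_integrable rho _ 1) => q.
  by rewrite indicE; case: (_ \in _); rewrite ?normr1 ?normr0.
rewrite integral_indic// setIT.
rewrite [X in (_ * X - _)%E](_ : _ = 1%E); last exact: probability_setT.
rewrite mule1 => h0.
have : (0 <= (N%:R * drift_const)%:E - (c * N%:R)%:E * rho D)%E by exact: h0.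
rewrite rD -EFinM -EFinB !lee_fin.
rewrite ler_pdivlMr// subr_ge0 => h.
rewrite -(ler_pM2l N0); apply: le_trans h.
by rewrite le_eqVlt; apply/orP; left; apply/eqP; ring.
Qed.

(** Continuity from below as $B \to \infty$: every state has a finite sum of cubes, and the bound
    does not involve [B]. *)
Lemma squares_tail_le (mu0 b : R) : 0 < mu0 -> 0 < b ->
  (forall j, mu0 <= mu j) ->
  (rho [set x | (b * N%:R < (squares x)%:R)%R] <=
   (drift_const / (3 / 2 * a * mu0 * b))%:E)%E.
Proof.
move=> mu00 b0 mu0P.
pose D B : set state := [set x | (b * N%:R < (squares x)%:R) && (cubes x < B)%N].
have -> : [set x | b * N%:R < (squares x)%:R] = \bigcup_B D B.
  apply/seteqP; split => [x /= bx|x [B _ /andP[]]//].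
  by exists (cubes x).+1 => //; rewrite /D/= bx ltnSn.
have cD : rho \o D @ \oo --> rho (\bigcup_B D B).
  apply: nondecreasing_cvg_mu => // m n mn; apply/subsetPset => x /andP[bx xm].
  by rewrite /D/= bx (leq_trans xm).
rewrite -(cvg_lim _ cD)//; apply: lime_le.
  by apply/cvg_ex; eexists; exact: cD.
by apply: nearW => B; exact: truncated_tail_le.
Qed.

(** Chebyshev by counting: each type [j] server with more than [i] jobs adds at least $(i+1)^2$ to
    [squares q], and type [j] has $N\gamma_j \ge N\gamma_0$ servers. *)
Lemma occ_quadratic_decay (gamma0 b : R) q : 0 < gamma0 -> 0 <= b ->
  (forall j, gamma0 <= gamma j) -> (squares q)%:R <= b * N%:R ->
  quadratic_decay (b / gamma0) (@occ R M gamma N q).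
Proof.
move=> g0 b0 gP Wb i j; rewrite /= /occ_fun.
have N0 : 0 < N%:R :> R by rewrite ltr0n; have [] := admN.
have gj : 0 < gamma j by exact: lt_le_trans (gP j).
rewrite nserversE ler_pdivrMr ?mulr_gt0// mulrAC ler_pdivlMr ?exprn_gt0//.
apply: (@le_trans _ _ (squares q)%:R); last first.
  apply: le_trans Wb _.
  rewrite [leRHS](_ : _ = b * N%:R * (gamma j / gamma0)); last first.
    by field; rewrite gt_eqF.
  by rewrite ler_peMr ?mulr_ge0// ler_pdivlMr// mul1r.
rewrite /squares natr_sum sum_server (bigD1 j)//=.
rewrite -[leLHS]addr0; apply: lerD; last by apply: sumr_ge0 => *; apply: sumr_ge0.
rewrite -sum1dep_card natr_sum mulr_suml big_mkcond/=.
apply: ler_sum => k _; case: ifP => [iq|_]; last exact: ler0n.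
by rewrite mul1r -natrX ler_nat leq_exp2r.
Qed.

End Lyapunov.

Theorem proposition13 (R : realType) (M : nat) (mu gamma : 'I_M -> R)
  (lambda : R)
  (M_gt0 : (0 < M)%N)
  (mu_decr : forall j k : 'I_M, (j < k)%N -> mu k < mu j)
  (mu_gt0 : forall j : 'I_M, 0 < mu j)
  (gamma_itv : forall j : 'I_M, 0 < gamma j <= 1)
  (gamma_sum : \sum_(j < M) gamma j = 1)
  (gamma_mu_sum : \sum_(j < M) gamma j * mu j = 1)
  (lambda_gt0 : 0 < lambda)
  (lambda_lt1 : lambda < 1)
  (P : forall N : nat,
    R -> R.-pker (qstate (server gamma N)) ~> (qstate (server gamma N)))
  (rho : forall N : nat, probability (qstate (server gamma N)) R)
  (P_sajsq : forall N : nat, admissible gamma N ->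
    transition_function (@Qmatrix R M mu gamma lambda N) (P N))
  (rho_stationary : forall N : nat, admissible gamma N ->
    occ_stationary (P N) (rho N)) :
  tight [set N : nat | admissible gamma N] (fun N : nat => occ_law (rho N)).
Proof.
move=> eps eps0.
have [mu0 mu00 mu0P] := finite_pos_lower_bound M mu mu_gt0.
have [gamma0 gamma00 gamma0P] : exists2 c, 0 < c & forall j, c <= gamma j.
  by apply: finite_pos_lower_bound => j; have /andP[] := gamma_itv j.
have a0 : 0 < 1 - lambda by rewrite subr_gt0.
pose d := 3 / 2 * (1 - lambda) * mu0.
have d0 : 0 < d by rewrite !mulr_gt0.
have D0 : 0 < drift_const lambda by rewrite addr_gt0// divr_gt0.
(* Chosen so that the tail bound $C / (d b)$ equals [eps] for every admissible $N$. *)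
pose b := drift_const lambda / (d * eps).
have b0 : 0 < b by rewrite divr_gt0// mulr_gt0.
exists (quadratic_decay (b / gamma0)); split.
  by apply: quadratic_decay_compact; rewrite divr_ge0// ltW.
move=> N admN; rewrite /occ_law.
have tail := squares_tail_le mu gamma lambda N mu_gt0 gamma_mu_sum lambda_gt0
  lambda_lt1 admN (P N) (rho N) (P_sajsq N admN) (rho_stationary N admN) mu0 b
  mu00 b0 mu0P.
rewrite (_ : drift_const lambda / _ = eps) in tail; last first.
  by rewrite -/d /b; field; rewrite !gt_eqF.
set T := [set x | _] in tail.
apply: (@le_trans _ _ (rho N (~` T))).
  have -> : rho N (~` T) = (1 - rho N T)%E by exact: probability_setC.
  by rewrite EFinB leeB.
apply: le_measure; rewrite ?inE//; try exact: qstate_measurable.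
move=> q /negP; rewrite -leNgt => qW.
by apply: occ_quadratic_decay => //; exact: ltW.
Qed.
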